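(* Let $\mathcal{H},\mathcal{H}'$ be real Hilbert spaces, $K:\mathcal{H}\to\mathcal{H}'$ a bounded linear operator with $\|K\|<1$, $g\in\mathcal{H}'$, and $(\varphi_\gamma)_{\gamma\in\Gamma}$ an orthonormal basis of $\mathcal{H}$. Let $\Gamma=\Gamma_1\cup\dots\cup\Gamma_n$ (disjoint union), let $W=(w_\gamma)_{\gamma\in\Gamma}$ satisfy $w_\gamma\ge c$ for all $\gamma\in\Gamma$ for some constant $c>0$, and let $\mathbf{P}=\{p_1,\dots,p_n\}$ with $p_i\in[1,2]$. Let $f^0\in\mathcal{H}$ and let $(f^m)_{m\ge0}$ be defined recursively by $$f^m=\mathbf{S}_{W,\mathbf{P}}\big(f^{m-1}+K^*(g-Kf^{m-1})\big),\qquad m\ge1.$$ Let $f^*$ be the weak limit of $(f^m)$, and put $u^m=f^m-f^*$ and $h=f^*+K^*(g-Kf^* )$. Then: A) $\|Ku^m\|\to0$ as $m\to\infty$. B) $\|\mathbf{S}_{W,\mathbf{P}}(h+u^m)-\mathbf{S}_{W,\mathbf{P}}(h)-u^m\|\to0$ as $m\to\infty$. C) If for some $a\in\mathcal{H}$ and some sequence $(v^m)_{m\in\mathbb{N}}$ in $\mathcal{H}$ one has $v^m\to0$ weakly and $\lim_{m\to\infty}\|\mathbf{S}_{W,\mathbf{P}}(a+v^m)-\mathbf{S}_{W,\mathbf{P}}(a)-v^m\|=0$, then $\|v^m\|\to0$ as $m\to\infty$. D) $\|u^m\|\to0$ as $m\to\infty$.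
   Context: For $f\in\mathcal{H}$ write $f_\gamma=\langle f,\varphi_\gamma\rangle$. For $w>0$ and $p\ge1$ the function $S_{w,p}:\mathbb{R}\to\mathbb{R}$ is defined as follows: if $p>1$, $S_{w,p}=F_{w,p}^{-1}$, the inverse of $F_{w,p}(t)=t+\frac{wp}{2}\operatorname{sign}(t)|t|^{p-1}$; if $p=1$, $S_{w,1}(t)=t-\frac w2$ for $t>\frac w2$, $S_{w,1}(t)=0$ for $|t|\le\frac w2$, $S_{w,1}(t)=t+\frac w2$ for $t<-\frac w2$. The operator $\mathbf{S}_{W,\mathbf{P}}:\mathcal{H}\to\mathcal{H}$ is $\mathbf{S}_{W,\mathbf{P}}(h)=\sum_{i=1}^n\sum_{\gamma\in\Gamma_i}S_{w_\gamma,p_i}(h_\gamma)\varphi_\gamma$. Equivalently, $f^m$ is the minimizer over $f$ of the surrogate functional $\|Kf-g\|^2+\sum_{i=1}^n\sum_{\gamma\in\Gamma_i}w_\gamma|f_\gamma|^{p_i}+\|f-f^{m-1}\|^2-\|K(f-f^{m-1})\|^2$. Under the stated assumptions the weak limit $f^*$ of $(f^m)$ exists. *)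

(* Defs.v *)
From HB Require Import structures.
From mathcomp Require Import all_boot all_order all_algebra finmap.
From mathcomp Require Import all_classical all_reals all_analysis.
From mathcomp.analysis.showcase Require summability.

Set Implicit Arguments.
Unset Strict Implicit.
Unset Printing Implicit Defensive.

Import Order.TTheory GRing.Theory Num.Theory.
Import numFieldNormedType.Exports.

Local Open Scope classical_set_scope.
Local Open Scope ring_scope.

(* A real Hilbert space is a complete normed module whose norm comes from an
   inner product; positive definiteness follows from [inner_normE]. *)
HB.mixin Record CompleteNormedModule_isHilbert (R : realType) H
    of CompleteNormedModule R H := {
  inner : H -> H -> R;
  inner_sym : forall x y, inner x y = inner y x;
  inner_linearl : forall (a : R) x y z,
    inner (a *: x + y) z = a * inner x z + inner y z;
  inner_normE : forall x, inner x x = `|x| ^+ 2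
}.

#[short(type="hilbertType")]
HB.structure Definition Hilbert (R : realType) :=
  {H of CompleteNormedModule R H & CompleteNormedModule_isHilbert R H}.

Notation "''<[' x , y ]>" := (inner x y)
  (at level 2, x, y at level 99, format "''<[' x ,  y ]>") : ring_scope.

Section operators.
Context {R : realType} {H H' : hilbertType R}.

Definition weak_cvg (v : nat -> H) (l : H) : Prop :=
  forall x : H, '<[v m, x]> @[m --> \oo] --> '<[l, x]>.

(* [sup] is 0 on unbounded sets, so this is the operator norm only when [K]
   is bounded. *)
Definition opnorm (K : H -> H') : R :=
  sup [set `|K x| | x in [set x : H | `|x| <= 1]].

(* For bounded linear [K] such an element exists and is unique (Riesz); the
   default value 0 is then never used. *)
Definition adjoint (K : H -> H') (y : H') : H :=
  xget 0 [set x : H | forall z : H, '<[K z, y]> = '<[z, x]>].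

End operators.

Section unconditional_sums.
Context {R : realType} {V : normedModType R} {I : choiceType}.

(* Limit of the net of finite partial sums, directed by inclusion; [I] may be
   uncountable. *)
Definition usum (A : set I) (x : I -> V) : V :=
  lim ((fun J : {fset I} => \sum_(i <- J | i \in A) x i)
         @ summability.totally).

End unconditional_sums.

Section bases.
Context {R : realType} {H : hilbertType R} {Gamma : choiceType}.

Definition finite_span (phi : Gamma -> H) : set H :=
  [set x | exists (J : {fset Gamma}) (c : Gamma -> R),
     x = \sum_(gamma <- J) c gamma *: phi gamma].

Definition orthonormal_basis (phi : Gamma -> H) : Prop :=
  (forall gamma delta, '<[phi gamma, phi delta]> = (gamma == delta)%:R)
  /\ closure (finite_span phi) = [set: H].

End bases.

Section thresholding.
Context {R : realType}.

Definition thresholdF (w p t : R) : R :=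
  t + w * p / 2 * Num.sg t * `|t| `^ (p - 1).

Definition soft_threshold (w t : R) : R :=
  if w / 2 < t then t - w / 2
  else if t < - (w / 2) then t + w / 2
  else 0.

(* For [0 < w] and [1 < p], [thresholdF w p] is a bijection of [R], and its
   partial inverse ['pinv] on the whole line is its inverse. *)
Definition threshold (w p : R) : R -> R :=
  if 1 < p then 'pinv_(fun=> 0) [set: R] (thresholdF w p)
  else soft_threshold w.

Definition Threshold {H : hilbertType R} {Gamma : choiceType} {n : nat}
    (phi : Gamma -> H) (G : 'I_n -> set Gamma) (w : Gamma -> R)
    (p : 'I_n -> R) (h : H) : H :=
  \sum_(i < n)
    usum (G i)
      (fun gamma => threshold (w gamma) (p i) '<[h, phi gamma]> *: phi gamma).

End thresholding.

(* Main.v *)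
Require Import Defs.
From mathcomp Require Import all_boot all_order all_algebra finmap.
From mathcomp Require Import all_classical all_reals all_analysis.
From mathcomp Require Import ring lra.
From mathcomp.analysis.showcase Require summability.

(** Let [A] be the adjoint of [K], [l] the weak limit of the iterates, and
[T x = S (x + A (g - K x))] the iteration map, where [S] is the thresholding
operator. Two facts about the factors of [T] carry the whole proof.

- In every coordinate [S] acts as the resolvent of a monotone function, so [S] is
  firmly nonexpansive: [S x - S y] has a nonnegative inner product with
  [(x - y) - (S x - S y)] ([Threshold_firm]), whence
  [|S x - S y|^2 + |(x - y) - (S x - S y)|^2 <= |x - y|^2] ([firm_dist]).
- As [K] is a contraction, the gradient step [B x = x + A (g - K x)] satisfies
  [|B x - B y|^2 <= |x - y|^2 - |K (x - y)|^2] and moves differences by at most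
  [|K (x - y)|] ([landweber_dist], [landweber_residual]).

The weak limit [l] is a fixed point of [T] by Opial's argument
([weak_limit_fixed]): expanding [|f_(m+1) - T l|^2] around [l] gives
[|f_(m+1) - l|^2 + |l - T l|^2] up to a cross term that vanishes by weak
convergence, while nonexpansiveness bounds it by [|f_m - l|^2]; were
[l <> T l], the nonnegative numbers [|f_m - l|^2] would eventually drop by a
fixed amount at every step. Once [T l = l], the two facts combine into
[|u_(m+1)|^2 + |(B f_m - B l) - u_(m+1)|^2 + |K u_m|^2 <= |u_m|^2].
So [|u_m|^2] converges and its successive differences tend to 0, which
is (A) and shows that [B f_m - B l] is asymptotic to both [u_m] and [u_(m+1)];
nonexpansiveness of [S] then gives (B).

For (C), the scalar inequality [threshold_defect_ge] says that near the origin
the thresholding functions are uniform strict contractions: if [|a|] and the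
defect [|S(a + v) - S(a) - v|] are below some [e], then [e |v|] is at most that
defect. All but finitely many coordinates of a fixed vector [a] are below [e].
On the finitely many others weak convergence gives [v_m -> 0]; on the rest the
norm of [v_m] is controlled by the norm of the defect
([Threshold_weak_strong]). Finally (D) is (C) for [a = h] and [v = u], by (B).

All comparisons in Hilbert space are reduced to coordinates through finite
sections: an element is within any [e > 0] of a finite orthogonal projection
([proj_dense]), and square-summable coefficients define an element
([span_cvg]); the latter also produces the adjoint of [K] ([adjointP]). *)

Set Implicit Arguments.
Unset Strict Implicit.
Unset Printing Implicit Defensive.

Import Order.TTheory GRing.Theory Num.Theory.
Import numFieldNormedType.Exports.

Local Open Scope classical_set_scope.
Local Open Scope ring_scope.

(** * Scalar thresholding functions *)

Section scalar_thresholding.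
Context {R : realType}.
Implicit Types (a b c p q t v w x y : R).

(** Concavity of the power function at 1: the tangent line of [expR] at
[q * ln x] lies below [expR] at [0] and at [ln x]; average the two inequalities
with weights [1 - q] and [q]. *)
Lemma powR_le_tangent q x : 0 < q <= 1 -> 0 <= x ->
  x `^ q <= 1 + q * (x - 1).
Proof.
move=> /andP[q0 q1]; rewrite le_eqVlt => /predU1P[<-|x0].
  by rewrite powR0 ?gt_eqF//; lra.
have xE : expR (ln x) = x by rewrite lnK// posrE.
rewrite /powR gt_eqF// -[in leRHS]xE; set l := ln x.
have tangent z : expR (q * l) * (1 + (z - q * l)) <= expR z.
  rewrite -[z in leRHS](subrK (q * l)) expRD mulrC.
  by rewrite ler_wpM2r ?expR_ge0// expR_ge1Dx.
have := tangent l; have := tangent 0; rewrite expR0.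
move: (expR (q * l)) (expR l) => e f; nra.
Qed.

(** The derivative [q * t `^ (q - 1)] is at least [q] on the unit interval. The
inequality at [x / y] rescales to this one because [y <= y `^ q] there. *)
Lemma powR_slope q x y : 0 < q <= 1 -> 0 <= x -> x <= y -> y <= 1 ->
  q * (y - x) <= y `^ q - x `^ q.
Proof.
move=> q01 x0 xy y1; have /andP[q0 q1] := q01.
have [y0|y0] := leP y 0.
  have -> : x = y by lra.
  by rewrite !subrr mulr0.
have yq : y <= y `^ q by rewrite ger1_powR ?y0.
have -> : x `^ q = (x / y) `^ q * y `^ q.
  by rewrite -powRM ?divfK ?gt_eqF ?divr_ge0 ?(ltW y0).
have := @powR_le_tangent q (x / y) q01 (divr_ge0 x0 (ltW y0)).
have := divfK (lt0r_neq0 y0) x.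
have : x / y <= 1 by rewrite ler_pdivrMr ?mul1r.
move: (x / y) ((x / y) `^ q) (y `^ q) yq => r rq Y yY r1 <- rqle.
have : (1 - r) * q * (Y - y) >= 0 by rewrite !mulr_ge0//; lra.
have : 0 <= (1 + q * (r - 1) - rq) * Y by rewrite mulr_ge0//; lra.
nra.
Qed.

(** Up to a constant factor, the derivative of [|t| `^ (q + 1)]. *)
Definition spow q t : R := Num.sg t * `|t| `^ q.

Lemma spowN q t : spow q (- t) = - spow q t.
Proof. by rewrite /spow sgrN normrN mulNr. Qed.

Lemma spow_ge0E q t : 0 < q -> 0 <= t -> spow q t = t `^ q.
Proof.
rewrite /spow le_eqVlt => q0 /predU1P[<-|t0].
  by rewrite sgr0 mul0r powR0 ?gt_eqF.
by rewrite gtr0_sg// mul1r gtr0_norm.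
Qed.

Lemma spow_le q x y : 0 < q -> x <= y -> spow q x <= spow q y.
Proof.
move=> q0.
have mono a b : 0 <= a -> a <= b -> spow q a <= spow q b.
  move=> a0 ab; rewrite !spow_ge0E ?(le_trans a0)//.
  by rewrite ge0_ler_powR ?nnegrE ?(ltW q0)// (le_trans a0).
have spow_ge0 a : 0 <= a -> 0 <= spow q a.
  by move=> a0; rewrite spow_ge0E ?powR_ge0.
move=> xy; have [x0|x0] := leP 0 x; first by apply: mono.
have [y0|y0] := leP 0 y.
  apply: (@le_trans _ _ 0); last exact: spow_ge0.
  by rewrite -oppr_ge0 -spowN spow_ge0 ?oppr_ge0 ?(ltW x0).
by rewrite -lerN2 -!spowN mono ?oppr_ge0 ?lerN2 ?(ltW y0).
Qed.

(** Strong monotonicity on [-1, 1]; for [q < 1] the slope degenerates at infinity,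
so that no bound of this kind is global. *)
Lemma spow_slope q x y : 0 < q <= 1 -> -1 <= x -> x <= y -> y <= 1 ->
  q * (y - x) <= spow q y - spow q x.
Proof.
move=> q01 x1 xy y1; have /andP[q0 q1] := q01.
have [x0|x0] := leP 0 x.
  by rewrite !spow_ge0E ?(le_trans x0)//; exact: powR_slope.
have sx : spow q x = - (- x) `^ q.
  by rewrite -{1}(opprK x) spowN spow_ge0E// ltW// oppr_gt0.
have [y0|y0] := leP 0 y.
  have hx : q * (- x - 0) <= (- x) `^ q - 0 `^ q by apply: powR_slope => //; lra.
  have hy : q * (y - 0) <= y `^ q - 0 `^ q by apply: powR_slope.
  rewrite spow_ge0E// sx; move: hx hy; rewrite powR0 ?gt_eqF//; lra.
have -> : spow q y = - (- y) `^ q.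
  by rewrite -{1}(opprK y) spowN spow_ge0E// ltW// oppr_gt0.
have : q * (- x - - y) <= (- x) `^ q - (- y) `^ q by apply: powR_slope => //; lra.
rewrite sx; lra.
Qed.

Lemma thresholdFE w p t : thresholdF w p t = t + w * p / 2 * spow (p - 1) t.
Proof. by rewrite /thresholdF /spow !mulrA. Qed.

(** Intermediate value theorem on [[0, t]], as [thresholdF w p t >= t]. *)
Lemma thresholdF_ge0_surj w p t : 0 < w -> 1 < p -> 0 <= t ->
  exists s, thresholdF w p s = t.
Proof.
move=> w0 p1 t0.
have q0 : 0 < p - 1 by lra.
pose F s := s + w * p / 2 * s `^ (p - 1).
have k0 : 0 < w * p / 2 by rewrite divr_gt0// mulr_gt0//; lra.
move: t0; rewrite le_eqVlt => /predU1P[<-|t0].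
  by exists 0; rewrite thresholdFE spow_ge0E// powR0 ?gt_eqF// mulr0 addr0.
have Fcont x : 0 < x -> F s @[s --> x] --> F x.
  move=> x0; apply: cvgD; first exact: cvg_id.
  apply: cvgM; first exact: cvg_cst.
  have : derivable (fun s : R => s `^ (p - 1)) x 1.
    by apply: derivable_powR; rewrite in_itv/= x0.
  by move=> /derivable1_diffP/differentiable_continuous.
have [] := @IVT R F 0 t t (ltW t0).
- apply/continuous_within_itvP => //; split.
  + by move=> x; rewrite in_itv/= => /andP[x0 _]; exact: Fcont.
  + rewrite /F powR0 ?gt_eqF//; apply: cvgD.
      exact/cvg_at_right_filter/cvg_id.
    by apply: cvgM; [exact: cvg_cst|rewrite ?powR0 ?gt_eqF//; exact: powR_cvg0].
  + exact/cvg_at_left_filter/Fcont.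
- rewrite {1 3}/F powR0 ?gt_eqF// mulr0 addr0.
  have Ft : t <= F t by rewrite lerDl mulr_ge0 ?powR_ge0 ?ltW.
  by rewrite ge_min (ltW t0)/= le_max Ft orbT.
move=> s; rewrite in_itv/= => /andP[s0 _] <-; exists s.
by rewrite thresholdFE spow_ge0E.
Qed.

Lemma thresholdK w p t : 0 < w -> 1 < p ->
  thresholdF w p (threshold w p t) = t.
Proof.
move=> w0 p1; rewrite /threshold p1 pinvK// inE.
have [t0|t0] := leP 0 t.
  by have [s <-] := thresholdF_ge0_surj w0 p1 t0; exists s.
have [|s sE] := @thresholdF_ge0_surj w p (- t) w0 p1; first by lra.
exists (- s) => //; move: sE; rewrite !thresholdFE spowN; lra.
Qed.

(** For [p > 1], [a - b] is the sum of the difference of the thresholded values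
and of [w * p / 2] times the difference of their signed powers, and these two
differences have the same sign. *)
Lemma threshold_firm w p a b : 0 < w -> 1 <= p ->
  0 <= (threshold w p a - threshold w p b)
       * ((a - b) - (threshold w p a - threshold w p b)).
Proof.
move=> w0; rewrite le_eqVlt => /predU1P[<-|p1].
  rewrite /threshold ltxx /soft_threshold.
  by case: (ltP (w / 2) a); case: (ltP a (- (w / 2)));
    case: (ltP (w / 2) b); case: (ltP b (- (w / 2))); nra.
have := thresholdK a w0 p1; have := thresholdK b w0 p1; rewrite !thresholdFE.
have k0 : 0 < w * p / 2 by rewrite divr_gt0// mulr_gt0//; lra.
have q0 : 0 < p - 1 by lra.
move: (w * p / 2) (threshold w p a) (threshold w p b) k0 => k x y k0 <- <-.
have -> : x + k * spow (p - 1) x - (y + k * spow (p - 1) y) - (x - y)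
  = k * (spow (p - 1) x - spow (p - 1) y) by lra.
rewrite mulrCA mulr_ge0 ?(ltW k0)//.
have [xy|/ltW xy] := leP x y; last by rewrite mulr_ge0 ?subr_ge0 ?spow_le.
by rewrite mulr_le0 ?subr_le0 ?spow_le.
Qed.

Lemma threshold0 w p : 0 < w -> 1 <= p -> threshold w p 0 = 0.
Proof.
move=> w0; rewrite le_eqVlt => /predU1P[<-|p1].
  by rewrite /threshold ltxx /soft_threshold !ifF//;
    apply/negbTE; rewrite -leNgt; lra.
have := thresholdK 0 w0 p1; rewrite thresholdFE.
have k0 : 0 < w * p / 2 by rewrite divr_gt0// mulr_gt0//; lra.
have q0 : 0 < p - 1 by lra.
have s0 : spow (p - 1) 0 = 0 by rewrite /spow sgr0 mul0r.
move: (threshold w p 0) => x.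
have [x0|x0|//] := ltgtP x 0; have := @spow_le (p - 1) _ _ q0 (ltW x0);
  rewrite s0; move: (spow _ _) => X; nra.
Qed.

Lemma threshold_norm_le w p a : 0 < w -> 1 <= p -> `|threshold w p a| <= `|a|.
Proof.
move=> w0 p1; have := threshold_firm a 0 w0 p1.
by rewrite threshold0// !subr0 => ?; rewrite !ler_norml; case: ler0P; nra.
Qed.

(** Here [a] lies at distance at least [c / 4] from the end of the dead zone. If
[a + v] leaves that zone, the defect is thus at least [c / 4]; otherwise both
values vanish and the defect is [|v|]. *)
Lemma soft_threshold_defect_ge c w a v : 0 < c -> c <= w -> `|a| <= c / 4 ->
  `|soft_threshold w (a + v) - soft_threshold w a - v| < c / 4 ->
  `|v| <= `|soft_threshold w (a + v) - soft_threshold w a - v|.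
Proof.
move=> c0 cw; rewrite ler_norml => /andP[a1 a2].
rewrite /soft_threshold [X in _ - X - _]ifF; last first.
  by apply/negbTE; rewrite -leNgt; lra.
rewrite [X in _ - X - _]ifF; last by apply/negbTE; rewrite -leNgt; lra.
rewrite ltr_norml; case: ifPn => h1; last case: ifPn => h2.
- lra.
- lra.
- by rewrite subr0 sub0r normrN.
Qed.

(** If [s'] left [-1, 1], monotonicity would force [G] to vary by at least
[k / 2] on the way from [s] to the nearest end point, against the hypothesis on
[G s' - G s]; hence [s'] stays where [G] is strongly monotone. *)
Lemma strongly_monotone_step_le (G : R -> R) k s s' : 0 < k ->
  {homo G : x y / x <= y} ->
  (forall x y, -1 <= x -> x <= y -> y <= 1 -> k * (y - x) <= G y - G x) ->
  `|s| <= 1 / 2 -> `|G s' - G s| < k / 2 ->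
  k * `|s' - s| <= `|G s' - G s|.
Proof.
move=> k0 Gle Gk; rewrite ler_norml ltr_norml => /andP[s1 s2] /andP[d1 d2].
have s'1 : s' <= 1.
  rewrite leNgt; apply/negP => s'1.
  by have := Gk s 1; have := Gle _ _ (ltW s'1); nra.
have s'2 : -1 <= s'.
  rewrite leNgt; apply/negP => s'2.
  by have := Gk (-1) s; have := Gle _ _ (ltW s'2); nra.
have [ss|/ltW ss] := leP s s'; have Gss := Gle _ _ ss.
  by rewrite !ger0_norm ?subr_ge0// Gk//; lra.
rewrite distrC [leRHS]distrC !ger0_norm ?subr_ge0//.
by rewrite Gk//; lra.
Qed.

(** The constant [e] is uniform in the weights [w >= c]: this is where a positive
lower bound on the weights is essential. For [p > 1], with
[s = threshold w p a], [s' = threshold w p (a + v)] and [G] the nonlinear part of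
[thresholdF], the defect is [|G s' - G s|] while
[v = (s' - s) + (G s' - G s)]. *)
Lemma threshold_defect_ge c p : 0 < c -> 1 <= p <= 2 ->
  exists2 e, 0 < e & forall w a v, c <= w -> `|a| <= e ->
    `|threshold w p (a + v) - threshold w p a - v| < e ->
    e * `|v| <= `|threshold w p (a + v) - threshold w p a - v|.
Proof.
move=> c0 /andP[]; rewrite le_eqVlt => /predU1P[<- _|p1 p2].
  exists (Num.min 1 (c / 4)); first by rewrite lt_min ltr01; lra.
  move=> w a v cw; rewrite /threshold ltxx le_min lt_min.
  move=> /andP[_ ac] /andP[_ d].
  apply: le_trans (soft_threshold_defect_ge c0 cw ac d).
  by rewrite ler_piMl// ge_min lexx.
pose k := c * (p - 1) / 2.
have k0 : 0 < k by rewrite divr_gt0// mulr_gt0//; lra.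
exists (Num.min (1 / 2) (Num.min (k / 2) (k / (1 + k)))).
  rewrite !lt_min; apply/and3P; split; [lra|lra|].
  by rewrite divr_gt0//; lra.
move=> w a v cw; rewrite le_min lt_min => /andP[a1 _] /andP[_].
rewrite lt_min => /andP[d _].
have w0 : 0 < w by lra.
set s := threshold w p a; set s' := threshold w p (a + v).
pose G t := w * p / 2 * spow (p - 1) t.
have vE : s' - s - v = - (G s' - G s).
  have := thresholdK a w0 p1; have := thresholdK (a + v) w0 p1.
  rewrite !thresholdFE -/s -/s' -/(G s) -/(G s'); lra.
have kw : k <= w * p / 2 * (p - 1).
  have : 0 <= (p - 1) * (w * p - c) by rewrite mulr_ge0//; nra.
  rewrite /k; lra.
have dG : `|G s' - G s| < k / 2 by rewrite -normrN -vE.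
have s12 : `|s| <= 1 / 2 by rewrite (le_trans _ a1)// threshold_norm_le// ltW.
have Gle : {homo G : x y / x <= y}.
  by move=> x y xy; rewrite /G ler_wpM2l ?spow_le//; [nra|lra].
have Gk x y : -1 <= x -> x <= y -> y <= 1 -> k * (y - x) <= G y - G x.
  move=> x1 xy y1; rewrite /G -mulrBr.
  apply: le_trans (ler_wpM2r _ kw) _; first by rewrite subr_ge0.
  rewrite -[leLHS]mulrA ler_wpM2l//; first by nra.
  by apply: spow_slope => //; lra.
have kD := strongly_monotone_step_le k0 Gle Gk s12 dG.
have vD : `|v| <= `|s' - s| + `|G s' - G s|.
  have -> : v = (s' - s) + (G s' - G s) by lra.
  exact: ler_normD.
rewrite vE normrN.
apply: (@le_trans _ _ (k / (1 + k) * (`|s' - s| + `|G s' - G s|))).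
  apply: ler_pM => //; last by rewrite !ge_min lexx !orbT.
  by rewrite !le_min; apply/and3P; split; rewrite divr_ge0//; lra.
rewrite mulrAC ler_pdivrMr; [nra|lra].
Qed.

End scalar_thresholding.

(** * Orthonormal expansions in a Hilbert space *)

Section inner_product.
Context {R : realType} {H : hilbertType R}.
Implicit Types (x y z : H) (a : R).

Lemma innerDl x y z : '<[x + y, z]> = '<[x, z]> + '<[y, z]>.
Proof. by have := inner_linearl 1 x y z; rewrite scale1r mul1r. Qed.

Lemma inner0l z : '<[0, z]> = 0 :> R.
Proof. by apply: (addrI '<[0, z]>); rewrite -innerDl !addr0. Qed.

Lemma innerZl a x z : '<[a *: x, z]> = a * '<[x, z]>.
Proof. by have := inner_linearl a x 0 z; rewrite addr0 inner0l addr0. Qed.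

Lemma innerNl x z : '<[- x, z]> = - '<[x, z]>.
Proof. by rewrite -scaleN1r innerZl mulN1r. Qed.

Lemma innerBl x y z : '<[x - y, z]> = '<[x, z]> - '<[y, z]>.
Proof. by rewrite innerDl innerNl. Qed.

Lemma innerDr x y z : '<[z, x + y]> = '<[z, x]> + '<[z, y]>.
Proof. by rewrite inner_sym innerDl !(inner_sym z). Qed.

Lemma innerNr x z : '<[z, - x]> = - '<[z, x]>.
Proof. by rewrite inner_sym innerNl inner_sym. Qed.

Lemma innerBr x y z : '<[z, x - y]> = '<[z, x]> - '<[z, y]>.
Proof. by rewrite innerDr innerNr. Qed.

Lemma inner_suml (I : Type) (r : seq I) (P : pred I) (F : I -> H) z :
  '<[\sum_(i <- r | P i) F i, z]> = \sum_(i <- r | P i) '<[F i, z]>.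
Proof.
exact: (big_morph (inner ^~ z) (fun x y => innerDl x y z) (inner0l z)).
Qed.

Lemma sqr_normD x y : `|x + y| ^+ 2 = `|x| ^+ 2 + 2 * '<[x, y]> + `|y| ^+ 2.
Proof.
rewrite -!inner_normE innerDl !innerDr (inner_sym y x).
by rewrite mulr_natl mulr2n !addrA.
Qed.

(** The triangle inequality for the given norm, squared and expanded. *)
Lemma cauchy_schwarz x y : `|'<[x, y]>| <= `|x| * `|y|.
Proof.
have CS z : '<[z, y]> <= `|z| * `|y|.
  have : `|z + y| ^+ 2 <= (`|z| + `|y|) ^+ 2.
    by rewrite lerXn2r ?nnegrE ?addr_ge0// ler_normD.
  by rewrite sqr_normD sqrrD -mulr_natl; lra.
by rewrite ler_norml lerNl -innerNl -{1}(normrN x) !CS.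
Qed.

Lemma inner_cvg (T : Type) (F : set_system T) {FF : Filter F}
    (v : T -> H) l y :
  v t @[t --> F] --> l -> '<[v t, y]> @[t --> F] --> '<[l, y]>.
Proof.
move=> vl; apply/cvgrPdist_lt => e e0.
have y0 : 0 < `|y| + 1 by rewrite ltr_wpDl.
near=> t; rewrite -innerBl; apply: (le_lt_trans (cauchy_schwarz _ _)).
apply: (@le_lt_trans _ _ (`|l - v t| * (`|y| + 1))).
  by rewrite ler_wpM2l// lerDl.
rewrite -ltr_pdivlMr//; near: t.
by apply: (cvgrPdist_lt _ _).1 => //; rewrite divr_gt0.
Unshelve. all: by end_near. Qed.

End inner_product.

Lemma sum_fset_sub (I : choiceType) (V : nmodType) (J J' : {fset I})
    (F : I -> V) : (J `<=` J')%fset ->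
  \sum_(i <- J') F i = \sum_(i <- J) F i + \sum_(i <- (J' `\` J)%fset) F i.
Proof.
move=> /fsubsetP JJ'; rewrite (big_fsetID _ (mem J))/=; congr (_ + _).
  apply: eq_fbigl => i; rewrite !inE/= andbC.
  by case: (boolP (i \in J)) => // /JJ' ->.
by apply: eq_fbigl => i; rewrite !inE/= andbC.
Qed.

Section orthonormal_expansion.
Context {R : realType} {H : hilbertType R} {Gamma : choiceType}.
Variable phi : Gamma -> H.
Hypothesis phi_basis : orthonormal_basis phi.
Implicit Types (x y : H) (c : Gamma -> R) (J : {fset Gamma}).

Lemma inner_basis g d : '<[phi g, phi d]> = (g == d)%:R :> R.
Proof. exact: phi_basis.1. Qed.

Lemma norm_basis g : `|phi g| = 1.
Proof.
apply/eqP; rewrite -(@eqrXn2 _ 2)// expr1n -inner_normE.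
by rewrite inner_basis eqxx.
Qed.

Lemma coord_span J c d :
  '<[\sum_(g <- J) c g *: phi g, phi d]> = if d \in J then c d else 0.
Proof.
rewrite inner_suml; under eq_bigr do rewrite innerZl inner_basis.
case: ifPn => dJ.
  rewrite (big_fsetD1 d)//= eqxx mulr1 big1_fset ?addr0// => i.
  by rewrite !inE => /andP[/negPf-> _]; rewrite mulr0.
rewrite big1_fset// => i iJ _; case: eqVneq => [id|_]; last by rewrite mulr0.
by rewrite -id iJ in dJ.
Qed.

Lemma inner_span J c x :
  '<[\sum_(g <- J) c g *: phi g, x]> = \sum_(g <- J) c g * '<[x, phi g]>.
Proof.
by rewrite inner_suml; apply: eq_bigr => g _; rewrite innerZl inner_sym.
Qed.

Lemma sqr_norm_span J c :
  `|\sum_(g <- J) c g *: phi g| ^+ 2 = \sum_(g <- J) c g ^+ 2.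
Proof.
rewrite -inner_normE inner_span; apply: eq_fbigr => g gJ _.
by rewrite coord_span gJ.
Qed.

(** Completing the square: among the combinations of a finite part of the basis,
the one with coefficients ['<[x, phi g]>] is the closest to [x]. *)
Lemma sqr_dist_span J c x :
  `|x - \sum_(g <- J) c g *: phi g| ^+ 2 =
  `|x| ^+ 2 - \sum_(g <- J) '<[x, phi g]> ^+ 2
  + \sum_(g <- J) (c g - '<[x, phi g]>) ^+ 2.
Proof.
rewrite sqr_normD normrN sqr_norm_span innerNr inner_sym inner_span.
rewrite -!addrA; congr (_ + _).
rewrite mulrN mulr_sumr -!sumrN -!big_split/=; apply: eq_bigr => g _; ring.
Qed.

Definition proj J x : H := \sum_(g <- J) '<[x, phi g]> *: phi g.

Lemma sqr_dist_proj J x :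
  `|x - proj J x| ^+ 2 = `|x| ^+ 2 - \sum_(g <- J) '<[x, phi g]> ^+ 2.
Proof.
rewrite sqr_dist_span [X in _ + X]big1 ?addr0// => g _.
by rewrite subrr expr0n.
Qed.

Lemma bessel J x : \sum_(g <- J) '<[x, phi g]> ^+ 2 <= `|x| ^+ 2.
Proof. by rewrite -subr_ge0 -sqr_dist_proj sqr_ge0. Qed.

Lemma coord_le x g : `|'<[x, phi g]>| <= `|x|.
Proof. by apply: (le_trans (cauchy_schwarz _ _)); rewrite norm_basis mulr1. Qed.

Lemma proj_dense x e : 0 < e -> exists J, `|x - proj J x| < e.
Proof.
move=> e0; have : closure (finite_span phi) x by rewrite phi_basis.2.
move=> /(_ (ball x e) (nbhsx_ballx x e e0)) [_ [[J [c ->]]]].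
rewrite -ball_normE /= => xe; exists J; apply: le_lt_trans xe.
rewrite -ler_sqr ?nnegrE//.
rewrite sqr_dist_proj sqr_dist_span lerDl.
by apply: sumr_ge0 => g _; rewrite sqr_ge0.
Qed.

(** The nontrivial half of the Parseval identity. *)
Lemma sqr_norm_le_coords x M :
  (forall J, \sum_(g <- J) '<[x, phi g]> ^+ 2 <= M) -> `|x| ^+ 2 <= M.
Proof.
move=> xM; apply/ler_addgt0Pl => e e0.
have [|J xJ] := @proj_dense x (Num.sqrt e); first by rewrite sqrtr_gt0.
have := sqr_dist_proj J x.
have : `|x - proj J x| ^+ 2 < e.
  by rewrite -[ltRHS]sqr_sqrtr ?(ltW e0)// ltrXn2r// ?nnegrE ?sqrtr_ge0.
have := xM J; lra.
Qed.

(** ['<[proj J x, y]>] is a finite sum of nonnegative terms, and approximates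
['<[x, y]>]. *)
Lemma inner_ge0_coords x y :
  (forall g, 0 <= '<[x, phi g]> * '<[y, phi g]>) -> 0 <= '<[x, y]> :> R.
Proof.
move=> xy; rewrite leNgt; apply/negP => xy0.
have y1 : 0 < `|y| + 1 by rewrite ltr_wpDl.
have [|J xJ] := @proj_dense x (- '<[x, y]> / (`|y| + 1)).
  by rewrite divr_gt0// oppr_gt0.
have : 0 <= '<[proj J x, y]> by rewrite inner_span sumr_ge0.
rewrite -[proj J x](subKr x) innerBl subr_ge0 => xPx.
have := cauchy_schwarz (x - proj J x) y; rewrite ltr_pdivlMr// in xJ.
rewrite ler_norml => /andP[+ _].
have := normr_ge0 (x - proj J x); lra.
Qed.

#[local] Existing Instance summability.totally_filter.

(** Cauchy criterion: once the sum of squares over [J] is within [e ^+ 2] of the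
supremum, adding further indices moves the partial sum by less than [e]. *)
Lemma span_cvg c M : (forall J, \sum_(g <- J) c g ^+ 2 <= M) ->
  cvg ((fun J => \sum_(g <- J) c g *: phi g) @ summability.totally).
Proof.
move=> cM; apply: cauchy_cvg; apply: cauchy_exP => e e0.
pose E := [set \sum_(g <- J) c g ^+ 2 | J in [set: {fset Gamma}]].
have supE : has_sup E.
  split; first by exists (\sum_(g <- fset0) c g ^+ 2); exists fset0.
  by exists M => _ [J _ <-].
have [|_ [J _ <-] supJ] := @sup_adherent _ E (e ^+ 2) _ supE.
  by rewrite exprn_gt0.
exists (\sum_(g <- J) c g *: phi g); exists J => // J' /= JJ'.
rewrite -ball_normE /= distrC -ltr_sqr ?nnegrE ?(ltW e0)//.
rewrite (sum_fset_sub _ JJ') addrAC subrr add0r sqr_norm_span.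
have := sup_upper_bound supE (ex_intro2 _ _ J' I erefl).
move: supJ; rewrite /= (sum_fset_sub _ JJ'); lra.
Qed.

(** The net of coordinates along [phi d] is eventually constant, from [[fset d]]
on. *)
Lemma usum_coord (A : set Gamma) c M d :
  (forall J, \sum_(g <- J) c g ^+ 2 <= M) ->
  '<[usum A (fun g => c g *: phi g), phi d]> = if d \in A then c d else 0.
Proof.
move=> cM; pose c' g := if g \in A then c g else 0.
rewrite /usum; have -> :
    (fun J : {fset Gamma} => \sum_(i <- J | i \in A) c i *: phi i)
    = (fun J : {fset Gamma} => \sum_(i <- J) c' i *: phi i).
  apply/funext => J; rewrite big_mkcond; apply: eq_bigr => g _.
  by rewrite /c'; case: ifP; rewrite ?scale0r.
have /cvg_ex[l Ul] :
  cvg ((fun J => \sum_(g <- J) c' g *: phi g) @ summability.totally).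
  apply: (@span_cvg _ M) => J; apply: le_trans (cM J); apply: ler_sum => g _.
  by rewrite /c'; case: ifP; rewrite // expr0n sqr_ge0.
rewrite (cvg_lim (@norm_hausdorff _ _) Ul).
rewrite -(cvg_lim (@norm_hausdorff _ _) (inner_cvg (y := phi d) Ul)).
apply: lim_near_cst => //.
exists [fset d]%fset => // J /=; rewrite fsub1set => dJ.
by rewrite coord_span dJ.
Qed.

End orthonormal_expansion.

(** * Null sequences *)

Lemma cvg0_of_sqr_le (R : realType) (V : normedModType R) (x : nat -> V)
    (r : nat -> R) :
  (\forall m \near \oo, `|x m| ^+ 2 <= r m) -> r m @[m --> \oo] --> (0 : R) ->
  `|x m| @[m --> \oo] --> (0 : R).
Proof.
move=> xr /cvgrPdist_lt r0; apply/cvgrPdist_lt => e e0.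
have := r0 _ (exprn_gt0 2 e0); apply: filterS2 xr => m xr.
rewrite !sub0r !normrN normr_id => /(le_lt_trans (ler_norm _)).
by move=> /(le_lt_trans xr); rewrite ltr_sqr ?nnegrE// ltW.
Qed.

Lemma cvg0_sqr (R : realType) (x : nat -> R) :
  x m @[m --> \oo] --> (0 : R) -> x m ^+ 2 @[m --> \oo] --> (0 : R).
Proof.
move=> x0; rewrite -[X in _ --> X](mulr0 0).
by under eq_fun do rewrite expr2; exact: cvgM.
Qed.

Lemma cvg0_sum (R : realType) (I : Type) (r : seq I) (x : I -> nat -> R) :
  (forall i, x i m @[m --> \oo] --> (0 : R)) ->
  \sum_(i <- r) x i m @[m --> \oo] --> (0 : R).
Proof.
move=> x0.
have contD : continuous (fun z : R * R => z.1 + z.2) by exact: add_continuous.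
have := @cvg_big R I +%R 0 xpredT contD nat \oo r x
  (fun=> 0) eventually_filter (fun i _ => x0 i).
by rewrite big1.
Qed.

(** A nonnegative sequence cannot lose the same amount [k] forever. *)
Lemma no_uniform_decrease (R : archiRealFieldType) (a : nat -> R) k N :
  0 < k -> (forall m, 0 <= a m) ->
  ~ (forall m, (N <= m)%N -> a m.+1 + k <= a m).
Proof.
move=> k0 a0 dec.
have lin j : a (N + j)%N + k * j%:R <= a N.
  elim: j => [|j IH]; first by rewrite addn0 mulr0 addr0.
  have := dec (N + j)%N (leq_addr _ _); rewrite addnS -natr1; lra.
have := archi_boundP (divr_ge0 (a0 N) (ltW k0)).
set j := Num.bound _ => ja; have := lin j; have := a0 (N + j)%N.
by move: ja; rewrite ltr_pdivrMr// mulrC; lra.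
Qed.

(** * Bounded operators and their adjoints *)

Section bounded_operators.
Context {R : realType} {H H' : hilbertType R} {Gamma : choiceType}.
Variables (phi : Gamma -> H) (K : {linear H -> H'}).
Hypothesis phi_basis : orthonormal_basis phi.
Hypothesis Kbounded : bounded_near K (nbhs (0 : H)).

Lemma bounded_linear_le : exists2 M, 0 < M & forall x, `|K x| <= M * `|x|.
Proof.
have /pinfty_ex_gt0[M M0 KM] := (linear_boundedP K).1 Kbounded.
by exists M.
Qed.

Lemma opnorm_le1 : opnorm K < 1 -> forall x, `|K x| <= `|x|.
Proof.
move=> K1 x; have [->|x0] := eqVneq x 0; first by rewrite linear0 !normr0.
have nx0 : 0 < `|x| by rewrite normr_gt0.
have [M M0 KM] := bounded_linear_le.
pose E := [set `|K z| | z in [set z : H | `|z| <= 1]].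
have ubE : has_ubound E.
  by exists M => _ [z /= z1 <-]; rewrite (le_trans (KM z))// ler_piMr// ltW.
have : `|K (`|x|^-1 *: x)| <= sup E.
  apply: ub_le_sup => //; exists (`|x|^-1 *: x) => //=.
  by rewrite normrZ normfV normr_id mulVf ?gt_eqF.
move=> /le_lt_trans /(_ K1).
by rewrite linearZ normrZ normfV normr_id mulrC ltr_pdivrMr// mul1r => /ltW.
Qed.

(** The Riesz representative of [z |-> '<[K z, y]>] is the vector with coordinates
['<[K (phi g), y]>]. Testing the functional on the finite sections of that vector
bounds the sums of squares by [(M * |y|) ^+ 2]; then both sides of the identity
agree on finite combinations of the basis and, by density, everywhere. *)
Lemma adjointP (y : H') (z : H) : '<[K z, y]> = '<[z, adjoint K y]> :> R.
Proof.
rewrite /adjoint; case: xgetP => [x _ //|noadj]; exfalso.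
have [M M0 KM] := bounded_linear_le.
pose c g := '<[K (phi g), y]> : R.
have Kspan J d :
    '<[K (\sum_(g <- J) d g *: phi g), y]> = \sum_(g <- J) d g * c g.
  rewrite linear_sum inner_suml; apply: eq_bigr => g _.
  by rewrite linearZ innerZl.
have c2 (J : {fset Gamma}) : \sum_(g <- J) c g ^+ 2 <= (M * `|y|) ^+ 2.
  set s := \sum_(g <- J) _.
  pose v := \sum_(g <- J) c g *: phi g.
  have vs : `|v| ^+ 2 = s by rewrite sqr_norm_span.
  have : `|v| ^+ 2 <= M * `|v| * `|y|.
    rewrite vs -[s]/(\sum_(g <- J) c g * c g) -Kspan.
    rewrite (le_trans (ler_norm _))// (le_trans (cauchy_schwarz _ _))//.
    by rewrite ler_wpM2r.
  rewrite -vs; have [->|v0] := eqVneq `|v| 0; first by rewrite expr0n sqr_ge0.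
  have vp : 0 < `|v| by rewrite lt_def v0 normr_ge0.
  rewrite expr2 mulrAC ler_pM2r// => vM.
  by rewrite -expr2 ler_sqr ?nnegrE// mulr_ge0// ltW.
(* it remains to refute that no representative exists, by exhibiting one *)
apply: (noadj (usum [set: Gamma] (fun g => c g *: phi g))) => x.
set l := usum _ _.
have lphi g : '<[l, phi g]> = c g.
  by rewrite /l (usum_coord phi_basis _ g c2) in_setT.
pose D := '<[K x, y]> - '<[x, l]> : R.
have Dle e : 0 < e -> `|D| <= e * (M * `|y| + `|l|).
  move=> e0; have [J xJ] := proj_dense phi_basis x e0.
  have -> : D = '<[K (x - proj phi J x), y]> - '<[x - proj phi J x, l]>.
    rewrite linearB !innerBl [in LHS]/D Kspan.
    have -> : '<[proj phi J x, l]> = \sum_(g <- J) '<[x, phi g]> * c g.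
      by rewrite inner_span; apply: eq_bigr => g _; rewrite lphi.
    by rewrite /D; ring.
  rewrite (le_trans (ler_normB _ _))// mulrDr lerD//.
    rewrite (le_trans (cauchy_schwarz _ _))// mulrA ler_wpM2r//.
    by rewrite (le_trans (KM _))// mulrC ler_wpM2r// ltW.
  by rewrite (le_trans (cauchy_schwarz _ _))// ler_wpM2r// ltW.
apply/eqP; rewrite -subr_eq0 -normr_le0 -/D; apply/ler_addgt0Pl => e e0.
have C0 : 0 < M * `|y| + `|l| + 1 by rewrite ltr_wpDl// addr_ge0// mulr_ge0// ltW.
rewrite addr0 (le_trans (Dle _ (divr_gt0 e0 C0)))// mulrAC ler_pdivrMr//.
by rewrite ler_wpM2l ?lerDl// ltW.
Qed.

End bounded_operators.

(** * The thresholding operator *)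

Section thresholding_operator.
Context {R : realType} {H : hilbertType R} {Gamma : choiceType} {n : nat}.
Variables (phi : Gamma -> H) (G : 'I_n -> set Gamma) (w : Gamma -> R).
Variables (p : 'I_n -> R) (c : R).
Hypothesis phi_basis : orthonormal_basis phi.
Hypothesis G_disj : trivIset [set: 'I_n] G.
Hypothesis G_cover : \bigcup_i G i = [set: Gamma].
Hypothesis c_gt0 : 0 < c.
Hypothesis w_ge : forall g, c <= w g.
Hypothesis p_range : forall i, 1 <= p i <= 2.
Local Notation S := (Threshold phi G w p).

Let w_gt0 g : 0 < w g. Proof. exact: lt_le_trans (w_ge g). Qed.
Let p_ge1 i : 1 <= p i. Proof. by have /andP[] := p_range i. Qed.

(** As thresholding does not increase absolute values, Bessel's inequality
makes the thresholded coefficients square summable; disjointness leaves only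
the class of [g] in the outer sum. *)
Lemma Threshold_coord i g x : G i g ->
  '<[S x, phi g]> = threshold (w g) (p i) '<[x, phi g]>.
Proof.
move=> Gig; rewrite /Threshold inner_suml.
pose s j d := threshold (w d) (p j) '<[x, phi d]>.
have coordE j : '<[usum (G j) (fun d => s j d *: phi d), phi g]>
    = if g \in G j then threshold (w g) (p j) '<[x, phi g]> else 0.
  apply: (@usum_coord _ _ _ _ phi_basis _ (s j) (`|x| ^+ 2)) => J.
  apply: le_trans (bessel phi_basis J x); apply: ler_sum => d _.
  rewrite -real_normK ?num_real// -[leRHS]real_normK ?num_real//.
  by rewrite ler_sqr ?nnegrE// threshold_norm_le.
rewrite (bigD1 i)//= coordE mem_set// big1 ?addr0// => j ji.
rewrite coordE memNset// => Gjg; move/eqP: ji; apply.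
by apply: (G_disj I I); exists g.
Qed.

Lemma ex_class g : exists i, G i g.
Proof.
have : (\bigcup_i G i) g by rewrite G_cover.
by move=> [i _ Gig]; exists i.
Qed.

Lemma Threshold_firm x y : 0 <= '<[S x - S y, (x - y) - (S x - S y)]> :> R.
Proof.
apply: (inner_ge0_coords phi_basis) => g; have [i Gig] := ex_class g.
by rewrite !innerBl !(Threshold_coord _ Gig) threshold_firm.
Qed.

(** The scalar constants depend only on [c] and on the exponent, and there are
finitely many exponents: their minimum serves all coordinates at once. *)
Lemma Threshold_defect_ge : exists2 e, 0 < e & forall a v g,
  `|'<[a, phi g]>| <= e -> `|'<[S (a + v) - S a - v, phi g]>| < e ->
  e * `|'<[v, phi g]>| <= `|'<[S (a + v) - S a - v, phi g]>|.
Proof.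
have /choice[e eP] : forall i, exists e, 0 < e /\ forall v a t, c <= v ->
    `|a| <= e -> `|threshold v (p i) (a + t) - threshold v (p i) a - t| < e ->
    e * `|t| <= `|threshold v (p i) (a + t) - threshold v (p i) a - t|.
  by move=> i; have [e e0 eP] := threshold_defect_ge c_gt0 (p_range i); exists e.
exists (\big[Num.min/1]_i e i); last move=> a v g.
  by apply: lt_bigmin => // i _; have [] := eP i.
have [i Gig] := ex_class g.
have mine : \big[Num.min/1]_i e i <= e i by exact: bigmin_le.
rewrite !innerBl !(Threshold_coord _ Gig) innerDl => ae de.
apply: (@le_trans _ _ (e i * `|'<[v, phi g]>|)); first by rewrite ler_wpM2r.
have [_ eiP] := eP i; apply: eiP => //; first exact: le_trans ae _.
exact: lt_le_trans de _.
Qed.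

(** A finite set [J] carries all coordinates of [a] above the threshold [e]; the
squared norm of [v m] splits into the part on [J], a finite sum tending to 0 by
weak convergence, and the part off [J], at most [e ^- 2] times the squared norm
of the defect. *)
Lemma Threshold_weak_strong a (v : nat -> H) : weak_cvg v 0 ->
  `|S (a + v m) - S a - v m| @[m --> \oo] --> (0 : R) ->
  `|v m| @[m --> \oo] --> (0 : R).
Proof.
move=> v0 d0; have [e e0 eP] := Threshold_defect_ge.
have [J aJ] := proj_dense phi_basis a e0.
have small g : g \notin J -> `|'<[a, phi g]>| <= e.
  move=> gJ; have := coord_le phi_basis (a - proj phi J a) g.
  (* off [J] the coordinates of [a] are those of [a - proj phi J a] *)
  rewrite innerBl (coord_span phi_basis) (negPf gJ) subr0 => /le_trans; apply.
  exact: ltW.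
pose d m := S (a + v m) - S a - v m.
pose r m := \sum_(g <- J) '<[v m, phi g]> ^+ 2 + e ^- 2 * `|d m| ^+ 2.
have r0 : r m @[m --> \oo] --> (0 : R).
  rewrite -[X in _ --> X]addr0; apply: cvgD.
    apply: cvg0_sum => g; apply: cvg0_sqr.
    by have := v0 (phi g); rewrite inner0l.
  rewrite -(mulr0 (e ^- 2)); apply: cvgM; first exact: cvg_cst.
  exact: cvg0_sqr.
have vr : \forall m \near \oo, `|v m| ^+ 2 <= r m.
  have : \forall m \near \oo, `|d m| < e.
    have /cvgrPdist_lt /(_ e e0) := d0.
    by apply: filterS => m; rewrite sub0r normrN normr_id.
  apply: filterS => m dme; rewrite /r -lerBlDl -(sqr_dist_proj phi_basis).
  apply: (sqr_norm_le_coords phi_basis) => J'.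
  apply: (@le_trans _ _ (e ^- 2 * \sum_(g <- J') '<[d m, phi g]> ^+ 2)).
    rewrite mulr_sumr; apply: ler_sum => g _.
    rewrite innerBl (coord_span phi_basis); case: ifPn => gJ.
      by rewrite subrr expr0n/= mulr_ge0 ?sqr_ge0// invr_ge0 exprn_ge0// ltW.
    rewrite subr0 mulrC ler_pdivlMr ?exprn_gt0// mulrC -exprMn.
    rewrite -real_normK ?num_real// -[leRHS]real_normK ?num_real//.
    rewrite ler_sqr ?nnegrE// normrM (gtr0_norm e0) eP ?small//.
    exact: le_lt_trans (coord_le phi_basis _ _) dme.
  by rewrite ler_wpM2l ?(bessel phi_basis)// invr_ge0 exprn_ge0// ltW.
exact: cvg0_of_sqr_le vr r0.
Qed.

End thresholding_operator.

(** * The iteration *)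

Section thresholded_landweber.
Context {R : realType} {H H' : hilbertType R}.
Variables (K : {linear H -> H'}) (A : H' -> H) (g : H') (S : H -> H).
Hypothesis K_le : forall x, `|K x| <= `|x|.
Hypothesis A_adj : forall y z, '<[K z, y]> = '<[z, A y]> :> R.
Hypothesis S_firm : forall x y, 0 <= '<[S x - S y, (x - y) - (S x - S y)]> :> R.

Local Notation landweber x := (x + A (g - K x)).

Lemma landweber_residualE x y z :
  '<[z, (landweber x - landweber y) - (x - y)]> = - '<[K z, K (x - y)]>.
Proof.
have -> : landweber x - landweber y - (x - y) = A (g - K x) - A (g - K y).
  by rewrite [- (y + _)]opprD addrACA [LHS]addrAC subrr add0r.
rewrite innerBr -!A_adj -innerBr -innerNr.
by congr ('<[_, _]>); rewrite (linearB K) [RHS]opprB opprB addrC addrA subrK.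
Qed.

(** From [landweber_residualE] with [z] the residual [d], and [|K d| <= |d|]. *)
Lemma landweber_residual x y :
  `|(landweber x - landweber y) - (x - y)| <= `|K (x - y)|.
Proof.
have := landweber_residualE x y; set d := _ - (x - y) => dE.
have [->|d0] := eqVneq d 0; first by rewrite normr0.
have dp : 0 < `|d| by rewrite normr_gt0.
rewrite -(ler_pM2l dp) -expr2 -inner_normE dE (le_trans (ler_norm _))// normrN.
by rewrite (le_trans (cauchy_schwarz _ _))// ler_wpM2r.
Qed.

(** The cross term of the expansion is [- 2 * |K (x - y)| ^+ 2], and the square of
the residual gives back at most one of these two. *)
Lemma landweber_dist x y :
  `|landweber x - landweber y| ^+ 2 <= `|x - y| ^+ 2 - `|K (x - y)| ^+ 2.
Proof.
have := landweber_residual x y; have := landweber_residualE x y (x - y).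
rewrite inner_normE; set d := _ - (x - y) => ud.
have -> : landweber x - landweber y = d + (x - y) by rewrite /d subrK.
by rewrite -ler_sqr ?nnegrE// (sqr_normD d) (inner_sym d) ud; lra.
Qed.

Lemma firm_dist x y :
  `|S x - S y| ^+ 2 + `|(x - y) - (S x - S y)| ^+ 2 <= `|x - y| ^+ 2.
Proof.
have := S_firm x y; have := sqr_normD (S x - S y) ((x - y) - (S x - S y)).
by rewrite [_ + (_ - _)]addrC subrK; lra.
Qed.

Lemma firm_nonexpansive x y : `|S x - S y| <= `|x - y|.
Proof.
rewrite -ler_sqr ?nnegrE//; apply: le_trans (firm_dist x y).
by rewrite lerDl sqr_ge0.
Qed.

Variables (f : nat -> H) (fstar : H).
Hypothesis f_rec : forall m, f m.+1 = S (landweber (f m)).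
Hypothesis f_weak : weak_cvg f fstar.

(** Opial's argument, run directly on the squared distances to [fstar]. *)
Lemma weak_limit_fixed : S (landweber fstar) = fstar.
Proof.
apply/eqP; rewrite -subr_eq0 -oppr_eq0 opprB -normr_eq0; set d := _ - _.
apply/negPn/negP => d0.
have dp : 0 < `|d| ^+ 2 / 2.
  by rewrite divr_gt0// exprn_gt0// lt_def d0 normr_ge0.
have : '<[f m - fstar, d]> @[m --> \oo] --> (0 : R).
  rewrite -[X in _ --> X](subrr '<[fstar, d]>).
  by under eq_fun do rewrite innerBl; apply: cvgB; [exact: f_weak|exact: cvg_cst].
move=> /cvgrPdist_lt /(_ (`|d| ^+ 2 / 4)) [|N _ small]; first by lra.
apply: (@no_uniform_decrease _ (fun m => `|f m - fstar| ^+ 2) _ N dp).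
  by move=> m; rewrite sqr_ge0.
move=> m Nm /=.
have := firm_nonexpansive (landweber (f m)) (landweber fstar).
rewrite -ler_sqr ?nnegrE// -f_rec => /le_trans /(_ (landweber_dist _ _)).
have -> : f m.+1 - S (landweber fstar) = (f m.+1 - fstar) + d.
  by rewrite /d addrA subrK.
rewrite (sqr_normD _ d).
have := small m.+1 (leqW Nm); rewrite /= sub0r normrN ltr_norml => /andP[du _].
have := sqr_ge0 `|K (f m - fstar)|; move: du; lra.
Qed.

Let u m := f m - fstar.
Let h := landweber fstar.
Let b m := landweber (f m) - h.

(** Energy balance of one step, available because [fstar] is a fixed point. *)
Lemma iterate_decrease m :
  `|u m.+1| ^+ 2 + `|b m - u m.+1| ^+ 2 <= `|u m| ^+ 2 - `|K (u m)| ^+ 2.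
Proof.
apply: le_trans (landweber_dist (f m) fstar).
have := firm_dist (landweber (f m)) h.
by rewrite -f_rec /h weak_limit_fixed.
Qed.

Lemma sqr_norm_gap_cvg0 :
  `|u m| ^+ 2 - `|u m.+1| ^+ 2 @[m --> \oo] --> (0 : R).
Proof.
have : cvgn (fun m => `|u m| ^+ 2).
  apply: nonincreasing_is_cvgn.
    apply/nonincreasing_seqP => m; have := iterate_decrease m.
    by have := sqr_ge0 `|b m - u m.+1|; have := sqr_ge0 `|K (u m)|; lra.
  by exists 0 => _ [m _ <-]; rewrite sqr_ge0.
move=> /cvg_ex[l ul]; rewrite -[X in _ --> X](subrr l).
by apply: cvgB => //; move: ul; rewrite -cvg_shiftS.
Qed.

Lemma residual_image_cvg0 : `|K (u m)| @[m --> \oo] --> (0 : R).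
Proof.
apply: cvg0_of_sqr_le sqr_norm_gap_cvg0; near=> m.
by have := iterate_decrease m; have := sqr_ge0 `|b m - u m.+1|; lra.
Unshelve. all: by end_near. Qed.

Lemma landweber_step_cvg0 : `|b m - u m.+1| @[m --> \oo] --> (0 : R).
Proof.
apply: cvg0_of_sqr_le sqr_norm_gap_cvg0; near=> m.
by have := iterate_decrease m; have := sqr_ge0 `|K (u m)|; lra.
Unshelve. all: by end_near. Qed.

(** [S (h + u m)] is compared with [S (h + b m) = f m.+1]: their distance is at
most [|b m - u m|], which is bounded by [|K (u m)|]. *)
Lemma fixed_point_defect_cvg0 :
  `|S (h + u m) - S h - u m| @[m --> \oo] --> (0 : R).
Proof.
have bound m : `|S (h + u m) - S h - u m|
    <= `|b m - u m.+1| + (`|K (u m)| + `|K (u m)|).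
  have bu : `|b m - u m| <= `|K (u m)| by exact: landweber_residual.
  have -> : S (h + u m) - S h - u m
      = (S (h + u m) - S (h + b m)) + ((b m - u m) - (b m - u m.+1)).
    have -> : h + b m = landweber (f m) by rewrite /b addrC subrK.
    have uE : u m.+1 = S (landweber (f m)) - S h.
      by rewrite -f_rec /h weak_limit_fixed.
    have -> : b m - u m - (b m - u m.+1) = u m.+1 - u m.
      by move: (b m) (u m) (u m.+1) => x y z; rewrite opprB addrC addrA subrK.
    rewrite uE; move: (S (h + u m)) (S (landweber _)) (S h) (u m) => x y z t.
    by rewrite 2!addrA subrK.
  have Su : `|S (h + u m) - S (h + b m)| <= `|K (u m)|.
    apply: le_trans (firm_nonexpansive _ _) _.
    by rewrite opprD addrACA subrr add0r distrC.
  rewrite (le_trans (ler_normD _ _))//.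
  by have := ler_normB (b m - u m) (b m - u m.+1); lra.
apply: (squeeze_cvgr (f := fun=> 0) (h :=
  fun m => `|b m - u m.+1| + (`|K (u m)| + `|K (u m)|))).
- by near=> m; rewrite normr_ge0 bound.
- exact: cvg_cst.
- rewrite -[X in _ --> X](addr0 0) -[X in _ --> _ + X](addr0 0).
  apply: cvgD; first exact: landweber_step_cvg0.
  by apply: cvgD; exact: residual_image_cvg0.
Unshelve. all: by end_near. Qed.

End thresholded_landweber.

(** * Strong convergence *)

Theorem theorem2p15 (R : realType) (H H' : hilbertType R)
  (K : {linear H -> H'}) (g : H')
  (hKbounded : bounded_near K (nbhs (0 : H))) (hK : opnorm K < 1)
  (Gamma : choiceType) (phi : Gamma -> H) (hphi : orthonormal_basis phi)
  (n : nat) (G : 'I_n -> set Gamma)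
  (hGdisj : trivIset [set: 'I_n] G) (hGcover : \bigcup_i G i = [set: Gamma])
  (w : Gamma -> R) (c : R) (hc : 0 < c) (hw : forall gamma, c <= w gamma)
  (p : 'I_n -> R) (hp : forall i, 1 <= p i <= 2)
  (f : nat -> H)
  (hf : forall m : nat,
     f m.+1 = Threshold phi G w p (f m + adjoint K (g - K (f m))))
  (fstar : H) (hfstar : weak_cvg f fstar) :
  let SWP := Threshold phi G w p in
  let u := fun m : nat => f m - fstar in
  let h := fstar + adjoint K (g - K fstar) in
  [/\ `|K (u m)| @[m --> \oo] --> (0 : R),
      `|SWP (h + u m) - SWP h - u m| @[m --> \oo] --> (0 : R),
      (forall (a : H) (v : nat -> H),
         weak_cvg v 0 ->
         `|SWP (a + v m) - SWP a - v m| @[m --> \oo] --> (0 : R) ->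
         `|v m| @[m --> \oo] --> (0 : R))
    & `|u m| @[m --> \oo] --> (0 : R)].
Proof.
have K_le := opnorm_le1 hKbounded hK.
have A_adj := adjointP hphi hKbounded.
have S_firm := Threshold_firm hphi hGdisj hGcover hc hw hp.
have partC := Threshold_weak_strong hphi hGdisj hGcover hc hw hp.
move=> SWP u h.
have partB := fixed_point_defect_cvg0 K_le A_adj S_firm hf hfstar.
split.
- exact: (residual_image_cvg0 K_le A_adj S_firm hf hfstar).
- exact: partB.
- exact: partC.
- apply: (partC h) => // x; rewrite inner0l /u.
rewrite -[X in _ --> X](subrr '<[fstar, x]>).
by under eq_fun do rewrite innerBl; apply: cvgB; [exact: hfstar|exact: cvg_cst].
Qed.
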